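(* Let $n\ge1$. The finite representation property holds for the signature $(\langle\ \rangle;,\mathsf A_1,\dots,\mathsf A_n,\cdot)$ for representation by $n$-ary partial functions and for representation by injective $n$-ary partial functions. That is: every finite algebra of this signature that is representable by $n$-ary partial functions is isomorphic to an algebra of $n$-ary partial functions with a finite base; and every finite algebra of this signature that is representable by injective $n$-ary partial functions is isomorphic to an algebra of $n$-ary partial functions that has a finite base and all of whose elements are injective.
   Context: Fix $n\ge 1$; $i$ ranges over $\{1,\dots,n\}$. The signature has an $(n+1)$-ary operation (composition), written $\langle a_1,\dots,a_n\rangle ; b$ (also $\boldsymbol a; b$), unary operations $\mathsf A_1,\dots,\mathsf A_n$, and a binary operation $\cdot$. Algebras are nonempty. An $n$-ary partial function on a set $X$ is a set $f\subseteq X^{n+1}$ such that $(\boldsymbol x,y),(\boldsymbol x,z)\in f$ implies $y=z$ (where $\boldsymbol x\in X^n$); it is injective if $(\boldsymbol x,z),(\boldsymbol y,z)\in f$ implies $\boldsymbol x=\boldsymbol y$. An algebra of $n$-ary partial functions of this signature is an algebra whose elements are $n$-ary partial functions, for which there are a set $X$ (the base) and an equivalence relation $E$ on $X$ such that every tuple $(x_1,\dots,x_{n+1})$ in every element lies in $X^{n+1}$ and has pairwise $E$-equivalent entries, and whose operations are $\boldsymbol f; g=\{(\boldsymbol x,z)\in X^{n+1} : \exists \boldsymbol y\in X^n,\ (\boldsymbol x,y_i)\in f_i \text{ for each } i \text{ and } (\boldsymbol y,z)\in g\}$, $\mathsf A_i(f)=\{(\boldsymbol x,x_i)\in X^{n+1}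 : x_1,\dots,x_n \text{ all } E\text{-equivalent and there is no } y\in X \text{ with } (\boldsymbol x,y)\in f\}$, $f\cdot g=f\cap g$. An algebra is representable by (injective) $n$-ary partial functions if it is isomorphic to an algebra of $n$-ary partial functions of the same signature (all of whose elements are injective). *)

(* Defs.v *)
From mathcomp Require Import all_boot.
From mathcomp Require Import boolp classical_sets functions cardinality.

Set Implicit Arguments.
Unset Strict Implicit.
Unset Printing Implicit Defensive.

Local Open Scope classical_set_scope.

Record algebra (n : nat) := Algebra {
  carrier :> Type;
  compose : n.-tuple carrier -> carrier -> carrier;
  antidomain : 'I_n -> carrier -> carrier;
  meet : carrier -> carrier -> carrier;
  carrier_inhabited : inhabited carrier }.

Definition is_morphism n (A B : algebra n) (h : A -> B) : Prop :=
  [/\ forall (a : n.-tuple A) (b : A),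
        h (compose a b) = compose (map_tuple h a) (h b),
      forall (i : 'I_n) (a : A), h (antidomain i a) = antidomain i (h a) &
      forall a b : A, h (meet a b) = meet (h a) (h b)].

Definition isomorphic n (A B : algebra n) : Prop :=
  exists h : A -> B, bijective h /\ is_morphism h.

(* A subset of X^(n+1), the last coordinate being split off. *)
Definition nrel (n : nat) (X : Type) := set (n.-tuple X * X).

Section PartialFunctions.
Variables (n : nat) (X : Type).
Implicit Types (f g : nrel n X) (E : X -> X -> Prop).

Definition is_pfun f : Prop :=
  forall x y z, f (x, y) -> f (x, z) -> y = z.

Definition is_injective f : Prop :=
  forall x y z, f (x, z) -> f (y, z) -> x = y.

Definition all_equiv E (x : n.-tuple X) : Prop :=
  forall i j, E (tnth x i) (tnth x j).

Definition within_equiv E f : Prop :=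
  forall x y, f (x, y) -> all_equiv E x /\ forall i, E (tnth x i) y.

Definition pcomp (f : n.-tuple (nrel n X)) g : nrel n X :=
  [set p | exists y : n.-tuple X,
     (forall i, tnth f i (p.1, tnth y i)) /\ g (y, p.2)].

Definition pantidom E (i : 'I_n) f : nrel n X :=
  [set p | [/\ p.2 = tnth p.1 i, all_equiv E p.1 &
               ~ exists y, f (p.1, y)]].

End PartialFunctions.

Record pfun_algebra (n : nat) := PfunAlgebra {
  base : Type;
  equ : base -> base -> Prop;
  equ_equivalence : RelationClasses.Equivalence equ;
  elements : set (nrel n base);
  elements_nonempty : elements !=set0;
  elements_pfun : forall f, elements f -> is_pfun f;
  elements_within : forall f, elements f -> within_equiv equ f;
  elements_comp : forall (f : n.-tuple (nrel n base)) g,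
    (forall i, elements (tnth f i)) -> elements g -> elements (pcomp f g);
  elements_antidom : forall i f, elements f -> elements (pantidom equ i f);
  elements_meet : forall f g, elements f -> elements g -> elements (f `&` g) }.

Section AlgebraOfPfunAlgebra.
Variables (n : nat) (B : pfun_algebra n).

Let elt := {f : nrel n (base B) | elements f}.

Lemma elt_comp_subproof (f : n.-tuple elt) (g : elt) :
  elements (pcomp (map_tuple sval f) (sval g)).
Proof.
by apply: elements_comp (svalP g) => i; rewrite tnth_map; apply: svalP.
Qed.

Lemma elt_inhabited : inhabited elt.
Proof. by have [f fB] := elements_nonempty B; exists; exists f. Qed.

Definition algebra_of_pfun_algebra : algebra n := {|
  carrier := elt;
  compose f g := exist _ (pcomp (map_tuple sval f) (sval g))
                      (elt_comp_subproof f g);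
  antidomain i f := exist _ (pantidom (@equ n B) i (sval f))
                         (elements_antidom i (svalP f));
  meet f g := exist _ (sval f `&` sval g)
                      (elements_meet (svalP f) (svalP g));
  carrier_inhabited := elt_inhabited |}.

End AlgebraOfPfunAlgebra.

Coercion algebra_of_pfun_algebra : pfun_algebra >-> algebra.

Definition injective_elements n (B : pfun_algebra n) : Prop :=
  forall f, @elements n B f -> is_injective f.

Definition representable n (A : algebra n) : Prop :=
  exists B : pfun_algebra n, isomorphic A B.

Definition injectively_representable n (A : algebra n) : Prop :=
  exists B : pfun_algebra n, injective_elements B /\ isomorphic A B.

(* Main.v *)
Require Import Defs.
From mathcomp Require Import all_boot.
From mathcomp Require Import boolp classical_sets functions cardinality.

(** Let [B] be a finite algebra of [n]-ary partial functions, over a base that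
    may be infinite.  Because of the antidomain operations, the domains of the
    elements of [B] form a finite Boolean algebra of sets of tuples, and every
    element can be restricted, inside [B], to any of these domains
    ([subtractE]).  Call an element of [B] an atom when its domain is an atom
    of that Boolean algebra.  Since [B] is finite, every element is the union of
    the atoms that it contains ([atom_below]).

    The finite base is the set of atoms: [B] is represented on it by right
    multiplication, as in Cayley's theorem.  An element [g] becomes the partial
    function that sends a tuple [f] of atoms to the composite [f; g] and is
    undefined where that composite is empty ([action]).  Two atoms are
    equivalent when they have the same domain.  This works because the domain
    of a nonempty composite [f; g] lies in the domain of each [f_i], hence
    equals it ([dom_compose_atom]): so a nonempty composite is again an atom,
    equivalent to all the [f_i], and for a tuple [f] of equivalent atoms either
    [f; g] is empty and [f; A_i(g)] is [f_i], or [f; A_i(g)] is empty.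
    Preservation of composition is the associativity of composition of partial
    functions.  The representation is faithful: if [g] contains [(x, y)], take
    an atom [e] below [g] that contains [(x, y)]; the tuple of projections on
    the domain of [e] is then sent to [e] by [g], and another element that
    also sends it to [e] contains [e] and hence [(x, y)] ([action_sub]).

    Injectivity of the elements passes to the new representation: if
    [f; g] and [f'; g] are the same atom, all the atoms involved have one
    domain, and injectivity of [g] makes [f] and [f'] agree at each point of it
    ([action_injective]). *)

Local Open Scope classical_set_scope.

(** * Isomorphisms and faithful representations *)

Section IsomorphismLemmas.
Set Implicit Arguments.
Unset Strict Implicit.
Variable n : nat.

Lemma isomorphic_trans (A B C : algebra n) :
  isomorphic A B -> isomorphic B C -> isomorphic A C.
Proof.
move=> [h [bij_h [hc ha hm]]] [k [bij_k [kc ka km]]].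
exists (k \o h); split; first exact: bij_comp.
split=> [a b|i a|a b] /=; last 2 first.
- by rewrite ha ka.
- by rewrite hm km.
rewrite hc kc; congr compose.
by apply: eq_from_tnth => i; rewrite !tnth_map.
Qed.

Lemma isomorphic_finite (A B : algebra n) :
  isomorphic A B -> finite_set [set: A] -> finite_set [set: B].
Proof.
move=> [h [[k _ kK] _]] finA.
apply: sub_finite_set (finite_image h finA) => b _.
by exists (k b).
Qed.

(** A set-theoretic representation amounts to an injective map into relations
    that turns the abstract operations into the concrete ones. *)
Lemma faithful_representation (A : algebra n) (Y : Type) (E : Y -> Y -> Prop)
    (theta : A -> nrel n Y) :
  RelationClasses.Equivalence E ->
  (forall a, is_pfun (theta a)) ->
  (forall a, within_equiv E (theta a)) ->
  (forall a b,
     theta (compose a b) = Defs.pcomp (map_tuple theta a) (theta b)) ->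
  (forall i a, theta (antidomain i a) = pantidom E i (theta a)) ->
  (forall a b, theta (meet a b) = theta a `&` theta b) ->
  injective theta ->
  exists B : pfun_algebra n,
    [/\ finite_set [set: Y] -> finite_set [set: base B],
        (forall a, is_injective (theta a)) -> injective_elements B &
        isomorphic A B].
Proof.
move=> eqE pf wi tc ta tm t_inj.
have ne : range theta !=set0.
  by have [a] := carrier_inhabited A; exists (theta a), a.
have cl_pfun f : range theta f -> is_pfun f by move=> [a _ <-].
have cl_within f : range theta f -> within_equiv E f by move=> [a _ <-].
have cl_comp (f : n.-tuple (nrel n Y)) g :
    (forall i, range theta (tnth f i)) -> range theta g ->
    range theta (Defs.pcomp f g).
  move=> rf [b _ <-].
  have /choice[a aE] : forall i, exists a, theta a = tnth f i.
    by move=> i; have [a _ <-] := rf i; exists a.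
  exists (compose [tuple a i | i < n] b) => //.
  rewrite tc; congr Defs.pcomp; apply: eq_from_tnth => i.
  by rewrite tnth_map tnth_mktuple aE.
have cl_anti i f : range theta f -> range theta (pantidom E i f).
  by move=> [a _ <-]; exists (antidomain i a).
have cl_meet f g : range theta f -> range theta g -> range theta (f `&` g).
  by move=> [a _ <-] [b _ <-]; exists (meet a b).
pose B := PfunAlgebra eqE ne cl_pfun cl_within cl_comp cl_anti cl_meet.
have in_range a : range theta (theta a) by exists a.
exists B; split=> //; first by move=> inj_t f [a _ <-].
pose h a : B := exist _ (theta a) (in_range a).
exists h; split.
  have /choice[k kP] : forall b : B, exists a, theta a = sval b.
    by move=> [f /= [a _ <-]]; exists a.
  exists k => [a|b]; first by apply: t_inj; rewrite kP.
  by case: b (kP b) => f rf /= kE; apply: eq_exist.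
split=> [a b|i a|a b]; apply: eq_exist => //=.
rewrite tc; congr Defs.pcomp.
by apply: eq_from_tnth => i; rewrite !tnth_map.
Qed.

End IsomorphismLemmas.

(** * Operations on elements and domains *)

Section CayleyRepresentation.
Set Implicit Arguments.
Unset Strict Implicit.
Variables (n : nat) (B : pfun_algebra n).
(** Composition with an empty tuple of functions would forget the domains, so
    an index is needed throughout. *)
Variable i0 : 'I_n.
Implicit Types (a b e g : B) (x : n.-tuple (base B)).

Definition dom a x : Prop := exists y, sval a (x, y).

Lemma elt_ext a b :
  (forall x y, sval a (x, y) <-> sval b (x, y)) -> a = b.
Proof.
case: a b => [f fB] [g gB] /= fg; apply: eq_exist.
by apply/predeqP => -[x y]; apply: fg.
Qed.

Lemma elt_fun a x y z : sval a (x, y) -> sval a (x, z) -> y = z.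
Proof. exact: (elements_pfun (svalP a)). Qed.

Lemma eq_of_sub_dom a b :
  (forall x y, sval a (x, y) -> sval b (x, y)) ->
  (forall x, dom b x -> dom a x) -> a = b.
Proof.
move=> sab dba; apply: elt_ext => x y; split=> [/sab //|bxy].
have [|y' axy'] := dba x; first by exists y.
by rewrite (elt_fun bxy (sab _ _ axy')).
Qed.

Lemma composeE (f : n.-tuple B) g x z :
  sval (compose f g) (x, z) <->
  exists y, (forall i, sval (tnth f i) (x, tnth y i)) /\ sval g (y, z).
Proof.
by split=> -[y [fy gy]]; exists y; split=> // i; move: (fy i);
  rewrite /= tnth_map.
Qed.

Lemma dom_compose (f : n.-tuple B) g i x :
  dom (compose f g) x -> dom (tnth f i) x.
Proof. by move=> [z /composeE[y [fy _]]]; exists (tnth y i). Qed.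

(** Functionality of the [f_i] lets the intermediate tuples that belong to the
    different [g_j] be identified. *)
Lemma composeA (f g : n.-tuple B) b :
  compose f (compose g b) = compose [tuple compose f (tnth g j) | j < n] b.
Proof.
apply: elt_ext => x z; split=> /composeE.
  move=> [y [fy /composeE[w [gw bw]]]]; apply/composeE.
  exists w; split=> // j; rewrite tnth_mktuple.
  by apply/composeE; exists y.
move=> [w [fgw bw]]; apply/composeE.
have fgw' j : exists y, (forall i, sval (tnth f i) (x, tnth y i)) /\
                        sval (tnth g j) (y, tnth w j).
  by move: (fgw j); rewrite tnth_mktuple => /composeE.
have [y [fy _]] := fgw' i0.
exists y; split=> //; apply/composeE; exists w; split=> // j.
have [y' [fy' gy']] := fgw' j.
suff <- : y' = y by [].
by apply: eq_from_tnth => i; apply: elt_fun (fy' i) (fy i).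
Qed.

Lemma compose_meet (f : n.-tuple B) a b :
  compose f (meet a b) = meet (compose f a) (compose f b).
Proof.
apply: elt_ext => x z; split.
  by move=> /composeE[y [fy [ay by_]]]; split; apply/composeE; exists y.
move=> [/composeE[y [fy ay]] /composeE[y' [fy' by']]].
apply/composeE; exists y; split=> //; split=> //.
suff -> : y = y' by [].
by apply: eq_from_tnth => i; apply: elt_fun (fy i) (fy' i).
Qed.

Lemma all_equiv_dom a x : dom a x -> all_equiv (@equ n B) x.
Proof. by move=> [y /(elements_within (svalP a))[]]. Qed.

Lemma antidomainE i a x y :
  sval (antidomain i a) (x, y) <->
  [/\ y = tnth x i, all_equiv (@equ n B) x & ~ dom a x].
Proof. by []. Qed.

Lemma dom_antidomain i a x :
  dom (antidomain i a) x <-> all_equiv (@equ n B) x /\ ~ dom a x.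
Proof.
split; first by move=> [y /antidomainE[]].
by move=> [Ex nax]; exists (tnth x i).
Qed.

(** The tuple of the [A_i(b)] is the identity outside the domain of [b]. *)
Definition subtract a b : B := compose [tuple antidomain i b | i < n] a.

Lemma subtractE a b x y :
  sval (subtract a b) (x, y) <-> sval a (x, y) /\ ~ dom b x.
Proof.
split=> [/composeE[w [bw aw]]|[axy nbx]].
  have xw : w = x.
    by apply: eq_from_tnth => i; move: (bw i); rewrite tnth_mktuple => -[].
  move: (bw i0); rewrite tnth_mktuple => -[_ _ nbx].
  by rewrite -xw in nbx *.
apply/composeE; exists x; split=> // i; rewrite tnth_mktuple.
by apply/antidomainE; split=> //; apply: (@all_equiv_dom a); exists y.
Qed.

Lemma dom_subtract a b x : dom (subtract a b) x <-> dom a x /\ ~ dom b x.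
Proof.
split; first by move=> [y /subtractE[axy nbx]]; split=> //; exists y.
by move=> [[y axy] nbx]; exists y; apply/subtractE.
Qed.

(** The projections restricted to the domain of [e]. *)
Definition dom_id e : n.-tuple B :=
  [tuple antidomain i (antidomain i e) | i < n].

Lemma dom_idE e i x y :
  sval (tnth (dom_id e) i) (x, y) <-> y = tnth x i /\ dom e x.
Proof.
rewrite tnth_mktuple; split.
  move=> /antidomainE[-> Ex nnex]; split=> //.
  by apply: contrapT => nex; apply: nnex; apply/dom_antidomain.
move=> [-> ex]; apply/antidomainE; split=> //.
  exact: all_equiv_dom ex.
by move=> /dom_antidomain[].
Qed.

Lemma dom_dom_id e i x : dom (tnth (dom_id e) i) x <-> dom e x.
Proof.
split; first by move=> [y /dom_idE[]].
by move=> ex; exists (tnth x i); apply/dom_idE.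
Qed.

Lemma compose_dom_id e g x y :
  sval (compose (dom_id e) g) (x, y) <-> dom e x /\ sval g (x, y).
Proof.
split=> [/composeE[w [ew gw]]|[ex gxy]].
  have <- : w = x by apply: eq_from_tnth => i; case/dom_idE: (ew i).
  split=> //.
  have -> : w = x by apply: eq_from_tnth => i; case/dom_idE: (ew i).
  by case/dom_idE: (ew i0).
by apply/composeE; exists x; split=> // i; apply/dom_idE.
Qed.

(** * Atoms *)

(** Being an atom is a condition on the domain: its domain is a minimal
    nonempty one, expressed so that it can be applied to any [b] directly. *)
Definition atom e : Prop :=
  (exists x, dom e x) /\
  forall b, (forall x, dom e x -> dom b x) \/ (forall x, dom e x -> ~ dom b x).

Lemma atom_dom e b x0 : atom e -> dom e x0 -> dom b x0 ->
  forall x, dom e x -> dom b x.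
Proof. by move=> [_ /(_ b)[//|dis]] /dis. Qed.

(** Deciding one domain after the other along an enumeration of [B], [a] is cut
    down, without losing the point [(x, y)], to an atom. *)
Lemma atom_below a x y : finite_set [set: B] -> sval a (x, y) ->
  exists e, [/\ atom e, sval e (x, y) &
                forall x' y', sval e (x', y') -> sval a (x', y')].
Proof.
move=> finB axy.
have /finite_seqP[s sE] : finite_set [set: {classic B}] by [].
have {sE} s_all b : (b : {classic B}) \in s.
  by have : [set: {classic B}] b by []; rewrite sE.
have [e [exy ea es]] : exists e, [/\ sval e (x, y),
    forall x' y', sval e (x', y') -> sval a (x', y') &
    forall b, (b : {classic B}) \in s ->
      (forall x', dom e x' -> dom b x') \/
      (forall x', dom e x' -> ~ dom b x')].
  elim: s {s_all} => [|b s [e [exy ea es]]]; first by exists a.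
  suff [e' [e'xy e'e e'b]] : exists e', [/\ sval e' (x, y),
      forall x' y', sval e' (x', y') -> sval e (x', y') &
      (forall x', dom e' x' -> dom b x') \/
      (forall x', dom e' x' -> ~ dom b x')].
    exists e'; split=> // [x' y' /e'e/ea //|c].
    rewrite inE => /predU1P[-> //|/es].
    by case=> ec; [left|right] => x' [y' /e'e ey']; apply: ec; exists y'.
  have [bx|nbx] := EM (dom b x).
    (* Subtracting the complement of a domain restricts to that domain. *)
    exists (subtract e (antidomain i0 b)); split.
    - by apply/subtractE; split=> // /dom_antidomain[].
    - by move=> x' y' /subtractE[].
    - left=> x' /dom_subtract[ex' nnb]; apply: contrapT => nb; apply: nnb.
      by apply/dom_antidomain; split=> //; apply: all_equiv_dom ex'.
  exists (subtract e b); split; first exact/subtractE.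
    by move=> x' y' /subtractE[].
  by right=> x' /dom_subtract[].
exists e; split=> //; split; first by exists x, y.
by move=> b; apply: es.
Qed.

Lemma dom_compose_atom (f : n.-tuple B) g i :
  atom (tnth f i) -> (exists x, dom (compose f g) x) ->
  forall x, dom (compose f g) x <-> dom (tnth f i) x.
Proof.
move=> atf [x0 fgx0] x; split; first exact: dom_compose.
exact: atom_dom atf (dom_compose i fgx0) fgx0 x.
Qed.

Lemma atom_compose (f : n.-tuple B) g :
  atom (tnth f i0) -> (exists x, dom (compose f g) x) -> atom (compose f g).
Proof.
move=> atf ne; split=> // b; have fgE := dom_compose_atom atf ne.
by have [_ /(_ b)[]] := atf => fb; [left|right] => x /fgE; apply: fb.
Qed.

(** * The action on atoms *)

Definition atoms := {e : B | atom e}.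
Implicit Types (f : n.-tuple atoms) (u v : atoms).

Definition same_dom u v : Prop := forall x, dom (sval u) x <-> dom (sval v) x.

Definition comp_atoms f g : B := compose (map_tuple sval f) g.

(** [B] acts on tuples of its atoms from the right; the value of [g] at [f] is
    defined when [f; g] is nonempty, since an atom [v] is nonempty. *)
Definition action g : nrel n atoms := [set p | sval p.2 = comp_atoms p.1 g].

Lemma finite_atoms : finite_set [set: B] -> finite_set [set: atoms].
Proof.
move=> finB; apply: sub_finite_set (finite_preimage (f := sval) _ finB) => //.
by move=> u v _ _; apply: eq_sig_hprop => *; apply: Prop_irrelevance.
Qed.

Lemma same_dom_equivalence : RelationClasses.Equivalence same_dom.
Proof.
split=> [u x|u v uv x|u v w uv vw x] //; first by split=> /uv.
by split=> [/uv/vw|/vw/uv].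
Qed.

Lemma action_val g f v i : action g (f, v) -> same_dom (tnth f i) v.
Proof.
rewrite /action /= => vE x; have [ne _] := svalP v.
rewrite vE in ne *; rewrite -(tnth_map sval f i).
by apply: iff_sym; apply: dom_compose_atom => //; rewrite tnth_map; apply: svalP.
Qed.

Lemma action_defined g f :
  (exists x, dom (comp_atoms f g) x) -> exists v, action g (f, v).
Proof.
move=> ne; have atfg : atom (comp_atoms f g).
  by apply: atom_compose => //; rewrite tnth_map; apply: svalP.
by exists (exist _ _ atfg).
Qed.

Lemma atoms_ext u v : sval u = sval v -> u = v.
Proof. by case: u v => [a pa] [b pb] /=; apply: eq_exist. Qed.

Lemma action_pfun g : is_pfun (action g).
Proof. by move=> f u v uE vE; apply: atoms_ext; rewrite [LHS]uE [RHS]vE. Qed.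

Lemma action_within g : within_equiv same_dom (action g).
Proof.
move=> f v fv; split=> [i j|i]; last exact: action_val fv.
by move=> x; split=> /(action_val _ fv)/(action_val _ fv).
Qed.

Lemma action_compose (a : n.-tuple B) b :
  action (compose a b) = Defs.pcomp (map_tuple action a) (action b).
Proof.
apply/predeqP => -[f v]; rewrite /Defs.pcomp /=.
have cA := composeA (map_tuple sval f) a b.
split=> [vE|[w [aw bw]]].
  have [[x vx] _] := svalP v; rewrite vE /comp_atoms cA in vx.
  have /choice[w wP] : forall j, exists u, action (tnth a j) (f, u).
    move=> j; apply: action_defined; exists x.
    by have := dom_compose j vx; rewrite tnth_mktuple.
  exists [tuple w j | j < n]; split=> [i|].
    by rewrite tnth_map tnth_mktuple.
  rewrite /action /= vE /comp_atoms cA; congr (@compose n B _ b).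
  by apply: eq_from_tnth => j; rewrite [RHS]tnth_map !tnth_mktuple; apply/esym/wP.
rewrite /action /= bw /comp_atoms cA; congr (@compose n B _ b).
apply: eq_from_tnth => j; rewrite tnth_mktuple tnth_map.
by move: (aw j); rewrite tnth_map.
Qed.

Lemma action_antidomain i a :
  action (antidomain i a) = pantidom same_dom i (action a).
Proof.
apply/predeqP => -[f v]; rewrite /pantidom /=.
(* Where [f; A_i(a)] is defined, its value is that of [f_i]. *)
have val_i x y : sval (comp_atoms f (antidomain i a)) (x, y) ->
    sval (sval (tnth f i)) (x, y).
  move=> /composeE[w [fw /antidomainE[-> _ _]]].
  by move: (fw i); rewrite tnth_map.
split=> [fv|[-> Ef nfa]].
  have [Ef fvi] := action_within fv; split=> //.
    apply: atoms_ext; apply: eq_of_sub_dom.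
      by move=> x y; rewrite [sval v]fv; apply: val_i.
    by move=> x; rewrite (fvi i x).
  move=> [u fu].
  have [[x vx] _] := svalP v.
  have ux : dom (sval u) x by apply/(action_val i0 fu)/(fvi i0).
  move: vx ux; rewrite [sval v]fv [sval u]fu.
  move=> [z /composeE[w [fw /antidomainE[_ _ naw]]]].
  move=> [z' /composeE[w' [fw' aw']]]; apply: naw.
  exists z'; suff -> : w = w' by [].
  by apply: eq_from_tnth => j; apply: elt_fun (fw j) (fw' j).
rewrite /action /=; apply/esym/eq_of_sub_dom => // x fix_.
have /choice[w wP] : forall j, exists y, sval (sval (tnth f j)) (x, y).
  by move=> j; have /(_ x)[+ _] := Ef i j; apply.
exists (w i); apply/composeE; exists [tuple w j | j < n]; split=> [j|].
  by rewrite tnth_map tnth_mktuple.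
apply/antidomainE; split; first by rewrite tnth_mktuple.
  (* The values [w j], [w k] are both equivalent to the entry of [x] at [i0]. *)
  move=> j k; rewrite !tnth_mktuple.
  have [_ /(_ i0) xj] := elements_within (svalP (sval (tnth f j))) (wP j).
  have [_ /(_ i0) xk] := elements_within (svalP (sval (tnth f k))) (wP k).
  have [_ sym tr] := equ_equivalence B.
  exact: tr (sym _ _ xj) xk.
move=> [z az]; apply: nfa; apply: action_defined.
exists x, z; apply/composeE; exists [tuple w j | j < n]; split=> // j.
by rewrite tnth_map tnth_mktuple.
Qed.

Lemma action_meet a b : action (meet a b) = action a `&` action b.
Proof.
apply/predeqP => -[f v]; have cm := compose_meet (map_tuple sval f) a b.
have meetE (c d : B) x y :
  sval (meet c d) (x, y) <-> sval c (x, y) /\ sval d (x, y) by [].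
split=> [vE|[va vb]]; last first.
  rewrite /action /= /comp_atoms cm -[compose _ b]vb -[compose _ a]va.
  by apply: elt_ext => x y; rewrite meetE; tauto.
rewrite /action /= /comp_atoms cm in vE.
(* As [v] is nonempty, all the composites share its domain. *)
have fi : atom (tnth (map_tuple sval f) i0) by rewrite tnth_map; apply: svalP.
have [ne _] := svalP v; have [x0 vx0] := ne.
have sub c : (forall x y, sval (sval v) (x, y) ->
    sval (compose (map_tuple sval f) c) (x, y)) ->
    sval v = compose (map_tuple sval f) c.
  move=> vc; apply: eq_of_sub_dom => // x /(dom_compose i0) fx.
  apply: (atom_dom fi _ vx0 fx); have [y vy] := vx0.
  by apply: (dom_compose (g := c)); exists y; apply: vc.
by split; apply: sub => x y; rewrite vE => /meetE[].
Qed.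

Lemma action_sub a b : finite_set [set: B] ->
  action a `<=` action b -> forall x y, sval a (x, y) -> sval b (x, y).
Proof.
move=> finB ab x y axy.
have [e [ate exy ea]] := atom_below finB axy.
have atid i : atom (tnth (dom_id e) i).
  have [[x0 ex0] dec] := ate.
  split; first by exists x0; apply/dom_dom_id.
  by move=> c; have [] := dec c => ec; [left|right] => x' /dom_dom_id; apply: ec.
pose f : n.-tuple atoms := [tuple exist _ _ (atid i) | i < n].
have fE : map_tuple sval f = dom_id e.
  by apply: eq_from_tnth => i; rewrite tnth_map [in LHS]tnth_mktuple.
have : action b (f, exist _ e ate).
  apply: ab; rewrite /action /comp_atoms /= fE.
  apply: eq_of_sub_dom => [x' y' exy'|x' [y' /compose_dom_id[]//]].
  by apply/compose_dom_id; split; [exists y' | apply: ea].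
rewrite /action /comp_atoms /= fE => eE.
by move: exy; rewrite eE => /compose_dom_id[].
Qed.

Lemma action_faithful : finite_set [set: B] -> injective action.
Proof.
by move=> finB a b ab; apply: elt_ext => x y; split; apply: action_sub => //;
  rewrite ab.
Qed.

Lemma action_injective g : is_injective (sval g) -> is_injective (action g).
Proof.
move=> inj_g f f' v fv f'v; apply: eq_from_tnth => i; apply: atoms_ext.
have dom_eq x : dom (sval (tnth f' i)) x -> dom (sval (tnth f i)) x.
  by move=> /(action_val _ f'v)/(action_val _ fv).
apply: eq_of_sub_dom => // x y fxy.
have [z vz] : dom (sval v) x by apply/(action_val i fv); exists y.
move: (vz) (vz); rewrite {1}[sval v]fv [sval v]f'v.
move=> /composeE[w [fw gw]] /composeE[w' [fw' gw']].
move: (fw i) (fw' i); rewrite !tnth_map -(inj_g _ _ _ gw gw') => fwi.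
by rewrite (elt_fun fxy fwi).
Qed.

Lemma finite_base : finite_set [set: B] ->
  exists C : pfun_algebra n,
    [/\ finite_set [set: base C],
        injective_elements B -> injective_elements C & isomorphic B C].
Proof.
move=> finB.
have [C [finC injC BC]] := faithful_representation same_dom_equivalence
  action_pfun action_within action_compose action_antidomain action_meet
  (action_faithful finB).
exists C; split=> //; first exact/finC/finite_atoms.
by move=> injB; apply: injC => a; apply: action_injective; apply/injB/svalP.
Qed.

End CayleyRepresentation.

Theorem corollary6p8 (n : nat) (n_ge1 : (1 <= n)%N) :
  (forall A : algebra n,
     finite_set [set: A] -> representable A ->
     exists B : pfun_algebra n,
       finite_set [set: base B] /\ isomorphic A B) /\
  (forall A : algebra n,
     finite_set [set: A] -> injectively_representable A ->
     exists B : pfun_algebra n,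
       [/\ finite_set [set: base B], injective_elements B & isomorphic A B]).
Proof.
split=> A finA => [[B AB]|[B [injB AB]]];
  have [C [finC injC BC]] :=
    @finite_base n B (Ordinal n_ge1) (isomorphic_finite AB finA);
  exists C; split=> //; try exact: isomorphic_trans AB BC.
exact: injC.
Qed.
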